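(* Let $X$ be a Cantor space. There exist continuum many (i.e. $2^{\aleph_0}$) pairwise distinct classes of weakly homeomorphic good measures in $M^0_\infty(X)$; that is, the equivalence relation of weak homeomorphism on the set of good measures in $M_\infty^0(X)$ has continuum many equivalence classes.
   Context: A Cantor space is a non-empty zero-dimensional compact perfect metric space. A Borel measure on a Cantor space $X$ is full if every non-empty open set has positive measure. $M_\infty(X)$ is the set of all full non-atomic Borel measures $\mu$ on $X$ with $\mu(X)=\infty$. For $\mu\in M_\infty(X)$ the defective set is $\mathfrak{M}_\mu=\{x\in X:\mu(U)=\infty\text{ for every clopen }U\ni x\}$, and $M^0_\infty(X)=\{\mu\in M_\infty(X):\mu(\mathfrak{M}_\mu)=0\}$. A measure $\mu\in M^0_\infty(X)$ is good if whenever $U,V$ are clopen subsets of $X$ with $\mu(U)<\mu(V)$, there is a clopen $W\subset V$ with $\mu(W)=\mu(U)$. Two infinite Borel measures $\mu,\nu$ on $X$ are weakly homeomorphic if there exist a self-homeomorphism $h$ of $X$ and a constant $C>0$ such that $h_*\mu=C\nu$. *)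

(* Defs.v *)
From HB Require Import structures.
From mathcomp Require Import all_boot all_order all_algebra.
From mathcomp Require Import all_classical all_reals all_analysis.

Set Implicit Arguments.
Unset Strict Implicit.
Unset Printing Implicit Defensive.

Import Order.TTheory GRing.Theory Num.Theory.
Import numFieldNormedType.Exports.

Local Open Scope classical_set_scope.
Local Open Scope ring_scope.
Local Open Scope ereal_scope.

(* Non-empty metric spaces: the distinguished point encodes non-emptiness, and
   is required by the library's measurable types. *)
#[short(type="pmetricType")]
HB.structure Definition PointedMetric (R : numDomainType) :=
  {M of Pointed M & Metric R M}.

Notation borel X := (g_sigma_algebraType (@open X)).

Section homeomorphism.
Context {X Y : topologicalType}.

Definition homeomorphism (h : X -> Y) : Prop :=
  exists g : Y -> X,
    [/\ cancel h g, cancel g h, continuous h & continuous g].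

End homeomorphism.

Section atoms.
Context d (T : measurableType d) (R : realType).

Definition atom (mu : set T -> \bar R) (A : set T) : Prop :=
  [/\ measurable A, 0 < mu A &
      forall B, measurable B -> B `<=` A -> mu B < mu A -> mu B = 0].

Definition non_atomic (mu : set T -> \bar R) : Prop := forall A, ~ atom mu A.

End atoms.

Section borel_measures.
Context {R : realType} {X : pmetricType R}.
Implicit Types mu nu : {measure set (borel X) -> \bar R}.

Definition full mu : Prop :=
  forall U : set X, open U -> U !=set0 -> 0 < mu U.

Definition Minfty : set {measure set (borel X) -> \bar R} :=
  [set mu | [/\ full mu, non_atomic mu & mu [set: X] = +oo]].

Definition defective mu : set X :=
  [set x | forall U : set X, clopen U -> U x -> mu U = +oo].

Definition Minfty0 : set {measure set (borel X) -> \bar R} :=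
  [set mu | Minfty mu /\ mu (defective mu) = 0].

Definition good : set {measure set (borel X) -> \bar R} :=
  [set mu | Minfty0 mu /\
    forall U V : set X, clopen U -> clopen V -> mu U < mu V ->
      exists W : set X, [/\ clopen W, W `<=` V & mu W = mu U]].

(* Equality of measures is equality on Borel sets: the values of a library
   measure outside the sigma-algebra carry no information. *)
Definition weakly_homeomorphic mu nu : Prop :=
  exists (h : borel X -> borel X) (C : R),
    [/\ @homeomorphism X X h, (0 < C)%R &
        forall A, measurable A -> pushforward mu h A = C%:E * nu A].

Definition weak_class mu : set {measure set (borel X) -> \bar R} :=
  [set nu | good nu /\ weakly_homeomorphic mu nu].

Lemma continuous_borel (h : X -> X) (A : set (borel X)) :
  continuous h -> measurable A -> measurable (h @^-1` A : set (borel X)).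
Proof.
move=> ch mA; rewrite -[_ @^-1` _]setTI.
have : measurable_fun [set: borel X] (h : borel X -> borel X).
  apply: (@measurability _ _ (borel X) (borel X) setT h (@open X)) => // _ [B oB <-].
  by rewrite setTI; apply: sub_sigma_algebra; apply: open_comp => // x _; exact: ch.
by apply.
Qed.

Lemma weakly_homeomorphic_refl mu : weakly_homeomorphic mu mu.
Proof.
exists id, 1%R; split => //; last by move=> A _; rewrite mul1e.
by exists id; split => // x; exact: cvg_id.
Qed.

Lemma weakly_homeomorphic_sym mu nu :
  weakly_homeomorphic mu nu -> weakly_homeomorphic nu mu.
Proof.
move=> [h [C [[g [hg gh ch cg]] C0 hmu]]].
exists g, C^-1%R; split; [by exists h | by rewrite invr_gt0|] => A mA.
have := hmu _ (continuous_borel cg mA).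
rewrite /pushforward.
have -> : h @^-1` (g @^-1` A) = A by apply/seteqP; split=> x /=; rewrite hg.
by move=> ->; rewrite muleA -EFinM mulVf ?mul1e// gt_eqF.
Qed.

Lemma weakly_homeomorphic_trans mu nu la : weakly_homeomorphic mu nu ->
  weakly_homeomorphic nu la -> weakly_homeomorphic mu la.
Proof.
move=> [h [C [[g [hg gh ch cg]] C0 hmu]]] [k [D [[l [kl lk ck cl]] D0 knu]]].
exists (k \o h), (C * D)%R; split; last 2 first.
- by rewrite mulr_gt0.
- move=> A mA; have := hmu _ (continuous_borel ck mA).
  by have := knu _ mA; rewrite /pushforward /= EFinM -muleA => ->.
exists (g \o l); split.
- exact: can_comp.
- exact: can_comp.
- by move=> x; apply: continuous_comp; [exact: ch | exact: ck].
- by move=> x; apply: continuous_comp; [exact: cl | exact: cg].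
Qed.

End borel_measures.

Arguments good {R} X.
Arguments weak_class {R X} mu.

(* Main.v *)
(** Classes inject into the continuum because a measure in [Minfty0 X] is
    determined by its values on the countably many clopen sets: off the null
    defective set, X is covered by clopen sets of finite measure.

    Conversely, for a set of primes [pi] containing 2, let G be the group of
    fractions m / N with all prime factors of N in [pi], and let K be obtained
    from the half-line by doubling every positive point of G and adding a point
    at infinity.  K is a Cantor space whose clopen sets are the finite unions of
    intervals with end points in G; Lebesgue measure makes it good, since up to a
    common denominator N such a set is a union of cells of length 1/N, and
    cells can be added one at a time until a prescribed measure is reached.
    The finite clopen values are the nonnegative elements of G, so
    for a prime p, weak homeomorphism preserves the p-divisibility of this set of
    values, that is, the condition that p is in [pi]. *)

Require Import Defs.
From HB Require Import structures.
From mathcomp Require Import all_boot all_order all_algebra.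
From mathcomp Require Import all_classical all_reals all_analysis.

Set Implicit Arguments.
Unset Strict Implicit.
Unset Printing Implicit Defensive.

Import Order.TTheory GRing.Theory Num.Theory.
Import numFieldNormedType.Exports.

Local Open Scope classical_set_scope.
Local Open Scope card_scope.
Local Open Scope ring_scope.

(** * Binary coding of a Cantor space *)

Definition agree n (y z : nat -> bool) := forall i, (i < n)%N -> y i = z i.

Lemma agree_refl n y : agree n y y. Proof. by []. Qed.

Lemma agree_sym n y z : agree n y z -> agree n z y.
Proof. by move=> a i /a. Qed.

Lemma agree_trans n y z t : agree n y z -> agree n z t -> agree n y t.
Proof. by move=> a b i ni; rewrite a// b. Qed.

Lemma agree_le m n y z : (m <= n)%N -> agree n y z -> agree m y z.
Proof. by move=> mn a i im; apply: a; exact: leq_trans mn. Qed.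

Section coding.
Context {R : realType} {X : pmetricType R}.

(** A homeomorphism of [X] with the Cantor set of binary sequences, phrased without a topology on
    sequences: coordinates are clopen and cylinders refine every open set. *)
Definition is_coding (e : X -> nat -> bool) (d : (nat -> bool) -> X) :=
  [/\ cancel e d, cancel d e, forall i, clopen [set x | e x i] &
      forall U x, open U -> U x ->
        exists n, forall y, agree n (e x) (e y) -> U y].

Lemma cantor_coding : cantor_like X -> exists e d, is_coding e d.
Proof.
move=> cantorX; have [_ cX _ _] := cantorX.
have [f [cf clf]] := @homeomorphism_cantor_like R X cantorX.
pose e (x : X) : nat -> bool := f^-1%FUN x.
have eK : cancel e f by move=> x; rewrite /e invK ?inE.
have fK : cancel f e by move=> x; rewrite /e funK ?inE.
have cle i b : closed [set x | e x i = b].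
  rewrite (_ : [set x | _] = f @` (proj i @^-1` [set b])).
    apply: clf; apply: preimage_closed; last exact: discrete_closed.
    by move=> y _; exact: proj_continuous.
  apply/seteqP; split=> [x /= xi|_ [y /= yi <-]]; last by rewrite fK.
  by exists (e x); rewrite ?eK.
have ope i b : open [set x | e x i = b].
  rewrite (_ : [set x | _] = ~` [set x | e x i = ~~ b]).
    by apply: closed_openC; exact: cle.
  by apply/seteqP; split=> x /=; case: (e x i) b => -[].
exists e, f; split => //; first by move=> i; split; [exact: ope | exact: cle].
move=> U x oU Ux.
(* Every point outside [U] differs from [x] in some coordinate. By compactness finitely many
   coordinates suffice, and [n] exceeds them all. *)
have : compact (~` U).
  by apply: (subclosed_compact _ cX) => //; exact: open_closedC.
rewrite compact_cover => /(_ _ setT (fun i => [set y | e y i = ~~ e x i])).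
case=> [i _|y Uy|D _ Dc]; first exact: ope.
  have /existsNP[i /eqP yi] : ~ forall i, e y i = e x i.
    move=> exy; apply: Uy; rewrite -(eK y) (_ : e y = e x) ?eK//.
    exact/funext.
  by exists i => //=; case: (e y i) (e x i) yi => -[].
exists (\max_(i <- finmap.enum_fset D) i).+1 => y xy.
apply: contrapT => /Dc[i /= iD].
rewrite xy ?ltnS; first by case: (e y i).
exact: leq_bigmax_seq.
Qed.

Variables (e : X -> nat -> bool) (d : (nat -> bool) -> X).
Hypothesis ed : is_coding e d.

Definition determined n (U : set X) :=
  forall x y, agree n (e x) (e y) -> U x -> U y.

Lemma determined_clopen n U : determined n U -> clopen U.
Proof.
have [eK dK cle _] := ed.
have cyl_open x : open [set y | agree n (e x) (e y)].
  elim: n => [|m IH].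
    by rewrite (_ : mkset _ = setT); [exact: openT | apply/seteqP].
  rewrite (_ : mkset _ = [set y | agree m (e x) (e y)] `&`
      [set y | e x m = e y m]).
    apply: openI => //; have [op cl] := cle m.
    case: (e x m); last first.
      by rewrite (_ : mkset _ = ~` [set y | e y m]);
        [exact: closed_openC | apply/seteqP; split=> y /=; case: (e y m)].
    by rewrite (_ : mkset _ = [set y | e y m]) //;
      apply/seteqP; split=> y /=; case: (e y m).
  apply/seteqP; split=> y /= => [a|[a am i]].
    by split; [apply: agree_le a | apply: a].
  by rewrite ltnS leq_eqVlt => /predU1P[->//|/a].
have det_open V : determined n V -> open V.
  move=> dV; rewrite (_ : V = \bigcup_(x in V) [set y | agree n (e x) (e y)]).
    by apply: bigcup_open => x _; exact: cyl_open.
  by apply/seteqP; split=> [y Vy|y [x Vx /dV]]; [exists y | exact].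
move=> dU; split; first exact: det_open.
rewrite -(setCK U); apply: open_closedC; apply: det_open => x y xy nUx Uy.
by apply: nUx; apply: dU Uy; exact: agree_sym.
Qed.

(** Near each point, finitely many coordinates decide membership in [U]; a finite subcover makes
    their number uniform. *)
Lemma clopen_determined U : compact [set: X] -> clopen U ->
  exists n, determined n U.
Proof.
have [_ _ _ base] := ed.
rewrite compact_cover => cX [oU cU].
pose ok n x := forall y, agree n (e x) (e y) -> U x <-> U y.
have /choice[N NP] x : exists n, ok n x.
  have [Ux|nUx] := pselect (U x).
    by have [n nP] := base _ _ oU Ux; exists n => y /nP.
  have [n nP] := base (~` U) x (closed_openC cU) nUx.
  by exists n => y /nP.
have [x _|x _|D _ DX] := cX X setT (fun x => [set y | agree (N x) (e x) (e y)]).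
- have /determined_clopen[]// : determined (N x) [set y | agree (N x) (e x) (e y)].
  by move=> y z yz /= xy; exact: agree_trans yz.
- by exists x.
- exists (\max_(i <- finmap.enum_fset D) N i) => x y xy Ux.
  have [z /= zD zx] := DX x Logic.I.
  have zy : agree (N z) (e z) (e y).
    by apply: agree_trans zx (agree_le _ xy); exact: leq_bigmax_seq.
  by apply: (NP z y zy).1; exact: (NP z x zx).2.
Qed.

(** The largest [n]-determined subset of [U]. These clopen sets exhaust an open [U], so clopen sets
    generate the Borel sets. *)
Definition inner n (U : set X) := [set x | forall y, agree n (e x) (e y) -> U y].

Lemma determined_inner n U : determined n (inner n U).
Proof. by move=> x y xy Ux z yz; apply: Ux; exact: agree_trans yz. Qed.

Lemma bigcup_inner U : open U -> U = \bigcup_n inner n U.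
Proof.
have [_ _ _ base] := ed.
move=> oU; apply/seteqP; split=> [x /(base _ _ oU)[n]|x [n _]]; first by exists n.
by apply; exact: agree_refl.
Qed.

Lemma clopen_measurable (U : set X) :
  clopen U -> measurable (U : set (borel X)).
Proof. by move=> [oU _]; exact: sub_sigma_algebra. Qed.

End coding.

(** * Determination by clopen values *)
Section determined_by_clopen.
Context {R : realType} {X : pmetricType R}.
Implicit Types mu nu : {measure set (borel X) -> \bar R}.
Hypothesis cantorX : cantor_like X.

Lemma borel_clopen :
  @measurable _ (borel X) = <<s (@clopen X : set (set (borel X))) >>.
Proof.
have [e [d ed]] := cantor_coding cantorX.
apply/seteqP; split; last first.
  by apply: sub_sigma_algebra2 => U [].
apply: smallest_sub; first exact: smallest_sigma_algebra.
move=> U oU; rewrite (bigcup_inner ed oU); apply: sigma_algebra_bigcup => n.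
apply: sub_sigma_algebra.
have := determined_clopen ed (@determined_inner _ _ e n U). exact.
Qed.

Definition agree_clopen mu nu := forall U : set X, clopen U -> mu U = nu U.

(** Restriction to [C] makes both measures finite, and the clopen sets are a generating family
    closed under intersection, so uniqueness of measures applies. *)
Lemma eq_measure_sub_clopen mu nu (C A : set (borel X)) :
  agree_clopen mu nu -> clopen (C : set X) -> (mu C < +oo)%E ->
  measurable A -> A `<=` C -> mu A = nu A.
Proof.
move=> E cC muC mA AC.
have mC : measurable C by exact: clopen_measurable.
rewrite -(setIidl AC).
pose m1 : {measure set (borel X) -> \bar R} := mrestr mu mC.
pose m2 : {measure set (borel X) -> \bar R} := mrestr nu mC.
have := @measure_unique _ R (borel X) (@clopen X) (fun=> setT) borel_clopen _ _ _
  m1 m2 _ _ A mA; apply => //.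
- by move=> U V; exact: clopenI.
- by move=> _; exact: clopenT.
- by rewrite bigcup_const.
- by move=> U cU; rewrite /= /mrestr E//; exact: clopenI.
- by move=> _; rewrite /= /mrestr setTI.
Qed.

Lemma Minfty0_eq mu nu : Minfty0 mu -> Minfty0 nu -> agree_clopen mu nu ->
  forall A : set (borel X), measurable A -> mu A = nu A.
Proof.
move=> [_ mu0] [_ nu0] E A mA.
have [_ cX _ _] := cantorX.
have [U] := clopen_surj cX.
(* Clopen sets of infinite measure are replaced by the empty set, so the union of the [g n] is the
   complement of the defective set. *)
pose g n : set (borel X) := if (mu (U n) < +oo)%E then U n else set0.
have cU n : clopen (U n) by exact: (@funS _ _ _ _ U n).
have cg n : clopen (g n : set X).
  by rewrite /g; case: ifP => _; [exact: cU | exact: clopen0].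
have mg n : measurable (g n) by exact: clopen_measurable.
have gfin n : (mu (g n) < +oo)%E.
  by rewrite /g; case: ifP => // _; rewrite measure0.
have dE (la : {measure set (borel X) -> \bar R}) : agree_clopen mu la ->
    defective la = ~` \bigcup_n g n.
  move=> Ela; apply/seteqP; split=> [x dx [n _]|x gx V cV Vx].
    rewrite /g; case: ifPn => // + Ux.
    by rewrite Ela// dx.
  have [n _ UnV] := @surj _ _ _ _ U V cV.
  apply/eqP; rewrite -leye_eq leNgt; apply/negP => Voo; apply: gx.
  by exists n => //; rewrite /g UnV Ela// Voo.
have mG : measurable (\bigcup_n g n) by exact: bigcup_measurable.
have mDU n : measurable (seqDU g n).
  by apply: measurableD => //; exact: bigsetU_measurable.
(* Off the null defective set, [A] is cut into disjoint pieces, each inside one clopen set of finite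
   measure. *)
have split_A (la : {measure set (borel X) -> \bar R}) : agree_clopen mu la ->
    la (defective la) = 0%E ->
    la A = (\sum_(n <oo) la (A `&` seqDU g n))%E.
  move=> Ela la0.
  rewrite (measureDI la mA mG) setDE -(dE _ Ela).
  rewrite (subset_measure0 _ _ _ la0) ?add0e//; last 2 first.
  - by apply: measurableI => //; rewrite (dE _ Ela); exact: measurableC.
  - by rewrite (dE _ Ela); exact: measurableC.
  rewrite seqDU_bigcup_eq setI_bigcupr; apply: measure_semi_bigcup.
  - by move=> n; apply: measurableI => //; exact: mDU.
  - by apply: trivIset_setIl; exact: trivIset_seqDU.
  - by apply: bigcup_measurable => n _; apply: measurableI => //; exact: mDU.
rewrite (split_A mu)// (split_A nu)//; apply: eq_eseriesr => n _.
apply: (eq_measure_sub_clopen E (cg n) (gfin n)).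
  by apply: measurableI => //; exact: mDU.
by apply: subset_trans (@subIsetr _ _ _) _; exact: subset_seqDU.
Qed.
End determined_by_clopen.

(** * Upper bound: at most continuum many classes *)

Section at_most_continuum.
Context {R : realType} {X : pmetricType R}.
Implicit Types mu nu : {measure set (borel X) -> \bar R}.
Hypothesis cantorX : cantor_like X.

Lemma weak_class_eq mu nu : good X mu -> weakly_homeomorphic mu nu ->
  weak_class mu = weak_class nu.
Proof.
move=> gmu munu; apply/seteqP; split=> la [gla wla]; split => //.
  by apply: weakly_homeomorphic_trans wla; exact: weakly_homeomorphic_sym.
exact: weakly_homeomorphic_trans wla.
Qed.

Lemma rat_between (x y : \bar R) : (0 <= x)%E -> (x < y)%E ->
  exists q : rat, (x <= (ratr q)%:E)%E && ((ratr q)%:E < y)%E.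
Proof.
case: x => [x| |] //; last by case: y.
move=> x0 xy.
have [r xr ry] : exists2 r : R, x < r & (r%:E <= y)%E.
  case: y xy => [y|_|]//; first by rewrite lte_fin; exists y.
  by exists (x + 1); [rewrite ltrDl | exact: leey].
have [q qi] := rat_in_itvoo xr; exists q.
move: qi; rewrite in_itv/= => /andP[xq qr].
by rewrite lee_fin (ltW xq)/= (lt_le_trans _ ry).
Qed.

Lemma card_weak_classes_le :
  [set weak_class mu | mu in good X] #<= [set: nat -> bool].
Proof.
have [_ cX _ _] := cantorX; have [U] := clopen_surj cX.
(* The bits of [F mu] record which rationals lie below the measure of each [U n]; these cuts
   determine all clopen values. *)
pose F mu (k : nat) : bool :=
  if @unpickle (nat * rat)%type k is Some (n, q) then
    ((ratr q)%:E < mu (U n : set (borel X)))%E else false.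
have F_clopen mu nu : F mu = F nu -> agree_clopen mu nu.
  move=> Fmunu V cV; have [n _ <-] := @surj _ _ _ _ U V cV.
  have Fn q : ((ratr q)%:E < mu (U n))%E = ((ratr q)%:E < nu (U n))%E.
    by have := congr1 (@^~ (pickle (n, q))) Fmunu; rewrite /F pickleK.
  have [munu|numu|//] := ltgtP (mu (U n)) (nu (U n)).
  - have [q /andP[]] := rat_between (measure_ge0 _ _) munu.
    by rewrite leNgt Fn => /negbTE ->.
  - have [q /andP[]] := rat_between (measure_ge0 _ _) numu.
    by rewrite leNgt -Fn => /negbTE ->.
(* The zero measure is a default value for those [c] that are not classes. *)
have /choice[rep repP] c : exists mu, [set weak_class mu | mu in good X] c ->
    good X mu /\ weak_class mu = c.
  have [[mu gmu <-]|nc] := pselect ([set weak_class mu | mu in good X] c).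
    by exists mu.
  by exists mzero.
apply/pcard_injP; exists (F \o rep) => b c /set_mem bP /set_mem cP /= Fbc.
have [gb <-] := repP b bP; have [gc <-] := repP c cP.
apply: weak_class_eq => //; exists id, 1; split => //.
  by exists id; split => // x; exact: cvg_id.
move=> A mA; rewrite mul1e /pushforward preimage_id.
by apply: Minfty0_eq mA => //; [exact: gb.1 | exact: gc.1 | exact: F_clopen].
Qed.

End at_most_continuum.

(** * Unions of cells of the half-line *)
Section gridded.
Context {R : realType}.
Implicit Types (A : set R) (N k t m : nat).
Local Notation lambda := (@lebesgue_measure R).

Definition grid N k : R := k%:R / N%:R.
Definition cell N k : set R := `[grid N k, grid N k.+1[.
(** For positive [N], [A] meets the half-line in a union of cells. Negative reals lie in no cell,
    hence the intersections with the half-line below. *)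
Definition gridded N A := forall k x y, cell N k x -> cell N k y -> A x -> A y.
Definition cnt N A t := (\sum_(k < t) `[< A (grid N k) >])%N.

Lemma grid0 N : grid N 0 = 0. Proof. by rewrite /grid mul0r. Qed.

Lemma gridD N k m : grid N (k + m) = grid N k + grid N m.
Proof. by rewrite /grid natrD mulrDl. Qed.

Lemma ler_grid N k m : (0 < N)%N -> (grid N k <= grid N m) = (k <= m)%N.
Proof. by move=> N0; rewrite ler_pM2r ?ler_nat// invr_gt0 ltr0n. Qed.

Lemma ltr_grid N k m : (0 < N)%N -> (grid N k < grid N m) = (k < m)%N.
Proof. by move=> N0; rewrite ltr_pM2r ?ltr_nat// invr_gt0 ltr0n. Qed.

Lemma grid_ge0 N k : 0 <= grid N k.
Proof. by rewrite divr_ge0. Qed.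

Lemma gridMl N n k : (0 < n)%N -> grid (n * N) (n * k) = grid N k.
Proof.
by move=> n0; rewrite /grid !natrM invfM mulrACA divff ?mul1r// pnatr_eq0 -lt0n.
Qed.

Lemma cellP N (x : R) : (0 < N)%N -> 0 <= x -> exists k, cell N k x.
Proof.
move=> N0 x0; have NR : 0 < N%:R :> R by rewrite ltr0n.
exists (Num.truncn (x * N%:R)); rewrite /cell/= in_itv/= /grid.
rewrite ler_pdivrMr// ltr_pdivlMr//.
by apply: truncn_itv; rewrite mulr_ge0// ltW.
Qed.

Lemma cell_grid N k : (0 < N)%N -> cell N k (grid N k).
Proof. by move=> N0; rewrite /cell/= in_itv/= lexx ltr_grid//=. Qed.

Lemma griddedMl N n A : (0 < n)%N -> (0 < N)%N -> gridded N A ->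
  gridded (n * N) A.
Proof.
move=> n0 N0 gA k x y.
have nN0 : (0 < n * N)%N by rewrite muln_gt0 n0.
have sub_cell : cell (n * N) k `<=` cell N (k %/ n).
  move=> z; rewrite /cell/= !in_itv/= => /andP[kz zk]; apply/andP; split.
    by apply: le_trans kz; rewrite -(gridMl N _ n0) ler_grid// mulnC leq_divM.
  by apply: (lt_le_trans zk); rewrite -(gridMl N _ n0) ler_grid// mulnC ltn_ceil.
by move=> /sub_cell kx /sub_cell ky; exact: gA kx ky.
Qed.

Lemma lambda_cell N k : (0 < N)%N -> lambda (cell N k) = (grid N 1)%:E.
Proof.
move=> N0; rewrite /cell lebesgue_measure_itv/= lte_fin ltr_grid// ltnSn.
by rewrite -EFinB /grid -mulrBl -natrB// subSnn.
Qed.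

Lemma cntS N A t : cnt N A t.+1 = (cnt N A t + `[< A (grid N t) >])%N.
Proof. by rewrite /cnt big_ord_recr. Qed.

Lemma lambda_initial N A t : (0 < N)%N -> measurable A -> gridded N A ->
  lambda (A `&` `[0, grid N t[) = (grid N (cnt N A t))%:E.
Proof.
move=> N0 mA gA; elim: t => [|t IH].
  by rewrite grid0 set_itvco0 setI0 measure0 /cnt big_ord0 grid0.
have -> : `[0, grid N t.+1[%classic = `[0, grid N t[ `|` cell N t.
  rewrite /cell -itv_bndbnd_setU// ?bnd_simp ?grid_ge0//.
  by rewrite ler_grid.
rewrite setIUr; have -> : lambda (A `&` `[0, grid N t[ `|` A `&` cell N t) =
    (lambda (A `&` `[0%R, grid N t[) + lambda (A `&` cell N t))%E;
  first apply: measureU.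
- exact: measurableI.
- by apply: measurableI => //; exact: measurable_itv.
- apply/seteqP; split=> // x [[_ /=]]; rewrite in_itv/= => /andP[_ xt] [_].
  by rewrite /cell/= in_itv/= leNgt xt.
rewrite IH cntS gridD EFinD; congr (_ + _)%E.
case: asboolP => [At|nAt].
  rewrite (_ : A `&` _ = cell N t) ?lambda_cell//.
  apply/seteqP; split=> [x []//|x tx]; split=> //.
  by apply: gA At; [exact: cell_grid | exact: tx].
rewrite (_ : A `&` _ = set0) ?measure0 ?grid0//.
apply/seteqP; split=> // x [Ax tx]; apply: nAt.
by apply: gA tx _ Ax; exact: cell_grid.
Qed.

Lemma cnt_homo N A : {homo cnt N A : s t / (s <= t)%N}.
Proof.
by apply: homo_leq => // [n m p|t]; [exact: leq_trans | rewrite cntS leq_addr].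
Qed.

(** The count starts at 0 and rises by at most one per cell, so it skips no value. *)
Lemma cnt_ivt N A t m : (m <= cnt N A t)%N -> exists s, cnt N A s = m.
Proof.
elim: t => [|t IH].
  by rewrite {1}/cnt big_ord0 leqn0 => /eqP->; exists 0%N; rewrite /cnt big_ord0.
rewrite leq_eqVlt => /predU1P[->|]; first by exists t.+1.
rewrite cntS => lt_m; apply: IH; rewrite -ltnS.
by apply: leq_trans lt_m _; rewrite -addn1 leq_add2l; case: asbool.
Qed.

(** A bounded count attains its maximum at some [t]; a cell of [A] from index [t] on would raise it
    further. *)
Lemma cnt_bounded N A m : (0 < N)%N -> gridded N A ->
  (forall t, (cnt N A t <= m)%N) ->
  exists t, A `&` `[0, +oo[ = A `&` `[0, grid N t[.
Proof.
move=> N0 gA Am.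
have ex : exists n, `[< exists t, cnt N A t = n >].
  by exists (cnt N A 0); apply/asboolP; exists 0%N.
have ub n : `[< exists t, cnt N A t = n >] -> (n <= m)%N.
  by move=> /asboolP[t <-].
case: (ex_maxnP ex ub) => n /asboolP[t tn] maxn; exists t.
apply/seteqP; split=> x [Ax]; rewrite /= in_itv/= ?andbT => x0; last first.
  by split=> //=; rewrite in_itv/= andbT; case/andP: x0.
split=> //=; rewrite in_itv/= x0/= ltNge; apply/negP => tx.
have [k kx] := cellP N0 x0.
have tk : (t <= k)%N.
  move: kx; rewrite /cell/= in_itv/= => /andP[_ xk].
  by rewrite -ltnS -(ltr_grid _ _ N0); exact: le_lt_trans xk.
have Ak : A (grid N k) by apply: gA kx _ Ax; exact: cell_grid.
have : (cnt N A k.+1 <= n)%N by apply: maxn; apply/asboolP; exists k.+1.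
rewrite cntS asboolT// addn1 -tn ltnNge => /negP; apply.
exact: cnt_homo.
Qed.

Lemma cnt_le_lambda N A t : (0 < N)%N -> measurable A -> gridded N A ->
  ((grid N (cnt N A t))%:E <= lambda (A `&` `[0%R, +oo[))%E.
Proof.
move=> N0 mA gA; rewrite -lambda_initial//; apply: le_measure.
- by rewrite inE; apply: measurableI.
- by rewrite inE; apply: measurableI.
- apply: setIS => x /=; rewrite !in_itv/= andbT.
  by case/andP.
Qed.

Lemma lambda_cnt_gt N A m : (0 < N)%N -> measurable A -> gridded N A ->
  ((grid N m)%:E < lambda (A `&` `[0%R, +oo[))%E -> exists t, (m < cnt N A t)%N.
Proof.
move=> N0 mA gA mlt; apply: contrapT => nex.
have le_m t : (cnt N A t <= m)%N.
  by rewrite leqNgt; apply/negP => mt; apply: nex; exists t.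
have [t At] := cnt_bounded N0 gA le_m.
by move: mlt; rewrite At lambda_initial// lte_fin ltr_grid// ltnNge le_m.
Qed.

Lemma lambda_gridded N A : (0 < N)%N -> measurable A -> gridded N A ->
  (lambda (A `&` `[0%R, +oo[) < +oo)%E ->
  exists m, lambda (A `&` `[0, +oo[) = (grid N m)%:E.
Proof.
move=> N0 mA gA Aoo.
have Afin : lambda (A `&` `[0, +oo[) \is a fin_num by rewrite ge0_fin_numE.
set a := fine (lambda (A `&` `[0, +oo[)).
(* A set of measure [a] has room for at most [a * N] cells of length [1 / N]. *)
have le_m t : (cnt N A t <= Num.truncn (a * N%:R))%N.
  rewrite truncn_ge_nat ?mulr_ge0 ?fine_ge0//.
  rewrite -ler_pdivrMr ?ltr0n// -lee_fin fineK//.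
  exact: cnt_le_lambda.
have [t At] := cnt_bounded N0 gA le_m.
by exists (cnt N A t); rewrite At lambda_initial.
Qed.

End gridded.

(** * Binary coding of the half-line *)
Section interval_coding.
Context {R : realType} (pi : nat_pred) (pi2 : 2%N \in pi).
Implicit Types (x y : R) (I : R * \bar R) (c : nat -> bool).

Definition frac x := exists N m, pi.-nat N /\ x = grid N m.

(* An enumeration of G; indices that do not encode an element of G give the
   junk value 0, which is never interior to an interval of the half-line. *)
Definition gpt n : R :=
  if @unpickle (nat * nat)%type n is Some (N, m) then
    if pi.-nat N then grid N m else 0
  else 0.

Lemma gpt_frac n : frac (gpt n).
Proof.
have frac0 : frac 0 by exists 1%N, 0%N; rewrite grid0; split.
rewrite /gpt; case: unpickle => [[N m]|//]; case: ifP => // piN.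
by exists N, m.
Qed.

Lemma frac_gpt x : frac x -> exists n, gpt n = x.
Proof.
by move=> [N [m [piN ->]]]; exists (pickle (N, m)); rewrite /gpt pickleK piN.
Qed.

(* A pair [I] stands for the interval [I.1, I.2[ of the half-line. *)
Definition valid I := 0 <= I.1 /\ (I.1%:E < I.2)%E.
Definition inside I x := (I.1 < x) && (x%:E < I.2)%E.
Definition between I x := (I.1 <= x) && (x%:E < I.2)%E.

(** Powers of 2 are admissible denominators; this is where 2 in [pi] makes G dense. *)
Lemma fine_pi x : 0 < x -> exists2 N, pi.-nat N & grid N 1 < x.
Proof.
move=> x0; pose k := Num.bound x^-1.
exists (2 ^ k)%N; first by rewrite pnatX pnatE// pi2.
have k2 : k%:R < (2 ^ k)%:R :> R by rewrite ltr_nat ltn_expl.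
rewrite /grid mul1r invf_plt ?posrE ?ltr0n ?expn_gt0//.
by apply: lt_trans k2; apply: archi_boundP; rewrite invr_ge0 ltW.
Qed.

Lemma gpt_dense I : valid I -> exists n, inside I (gpt n).
Proof.
case: I => a b [/= a0 ab].
have [r ar rb] : exists2 r : R, a < r & (r%:E <= b)%E.
  case: b ab => [b|_|]//; first by rewrite lte_fin; exists b.
  by exists (a + 1); [rewrite ltrDl | exact: leey].
have [N piN Nlt] : exists2 N, pi.-nat N & grid N 1 < r - a.
  by apply: fine_pi; rewrite subr_gt0.
have N0 : (0 < N)%N by case/andP: piN.
have [k] := cellP N0 a0.
rewrite /cell/= in_itv/= => /andP[ka ak].
(* The right end of the cell containing [a] exceeds [a] by at most [1 / N], hence stays below
   [r]. *)
have [|n nE] := @frac_gpt (grid N k.+1); first by exists N, k.+1.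
exists n; rewrite /inside/= nE ak/=; apply: lt_le_trans rb; rewrite lte_fin.
by rewrite -addn1 gridD -(subrKC a r); exact: ler_ltD.
Qed.

(* Cutting at the element of G of least index forces every positive element of
   G to become an end point after finitely many steps. *)
Definition cut I : R :=
  if pselect (exists n, inside I (gpt n)) is left ex then gpt (ex_minn ex)
  else 0.

Definition step I (b : bool) : R * \bar R :=
  if b then (cut I, I.2) else (I.1, (cut I)%:E).

Lemma cut_frac I : frac (cut I).
Proof.
rewrite /cut; case: pselect => [ex|_]; first exact: gpt_frac.
by exists 1%N, 0%N; rewrite grid0; split.
Qed.

Lemma cut_inside I : valid I -> inside I (cut I).
Proof.
move=> /gpt_dense ex; rewrite /cut; case: pselect => // ex'.
by case: ex_minnP.
Qed.

Lemma valid_step I b : valid I -> valid (step I b).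
Proof.
move=> vI; have /andP[lt1 lt2] := cut_inside vI; case: vI => halfline _.
by case: b; split => //=; exact: le_trans (ltW lt1).
Qed.

Lemma inside_step I b x : valid I -> inside (step I b) x -> inside I x.
Proof.
move=> /cut_inside/andP[lt1 lt2]; rewrite /inside /step; case: b => /= /andP[l1 l2].
  by rewrite l2 (lt_trans lt1).
by rewrite l1 (lt_trans _ lt2).
Qed.

Lemma between_step I b x : valid I ->
  between (step I b) x = between I x && (b == (cut I <= x)).
Proof.
move=> /cut_inside/andP[lt1 lt2]; rewrite /between /step; case: b => /=.
  have [sx|xs] := leP (cut I) x; last by rewrite andbF.
  by rewrite (le_trans (ltW lt1) sx) eqxx andbT.
rewrite lte_fin; have [sx|xs] := leP (cut I) x; first by rewrite !andbF.
by rewrite !andbT (lt_trans _ lt2) ?andbT// lte_fin.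
Qed.

(** If [gpt k] is inside [I], then [k] is the least such index, so [gpt k] is the cut and becomes an
    end point of both halves. *)
Lemma step_avoids I b k : valid I ->
  (forall i, (i < k)%N -> ~~ inside I (gpt i)) ->
  forall i, (i < k.+1)%N -> ~~ inside (step I b) (gpt i).
Proof.
move=> vI Ik i; rewrite ltnS leq_eqVlt => /predU1P[->{i}|ik]; last first.
  by apply: contra (Ik i ik); exact: inside_step.
have [kI|] := boolP (inside I (gpt k)); last by apply: contra; exact: inside_step.
have -> : gpt k = cut I.
  rewrite /cut; case: pselect => [ex|[]]; last by exists k.
  case: ex_minnP => j jI jmin; congr gpt; apply/eqP.
  by rewrite eqn_leq jmin// andbT leqNgt; apply: contraL jI; exact: Ik.
by rewrite /inside /step; case: b; rewrite /= ltxx ?andbF.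
Qed.

(** The path of [x] in the binary tree of intervals: each bit tells the side of the current cut, a
    cut point itself going right. *)
Fixpoint code I x n : bool :=
  if n is n'.+1 then code (step I (cut I <= x)) x n' else cut I <= x.

Fixpoint node I c n : R * \bar R :=
  if n is n'.+1 then node (step I (c 0%N)) (c \o succn) n' else I.

Lemma agreeS n c c' :
  agree n.+1 c c' <-> c 0%N = c' 0%N /\ agree n (c \o succn) (c' \o succn).
Proof.
split=> [a|[a0 a] [//|i]]; last exact: a.
by split=> [|i ni]; apply: a.
Qed.

Lemma valid_node I c n : valid I -> valid (node I c n).
Proof. by elim: n I c => //= n IH I c vI; apply: IH; exact: valid_step. Qed.

Lemma between_node I c n x : valid I ->
  between (node I c n) x <-> between I x /\ agree n c (code I x).
Proof.
elim: n I c => /= [|n IH] I c vI; first by split=> [|[]].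
rewrite IH; last exact: valid_step.
rewrite between_step// agreeS; split.
  move=> [/andP[-> /eqP c0] a]; split=> //; split=> //.
  by move: a; rewrite c0.
move=> [-> [c0 a]]; rewrite c0 eqxx; split=> //.
Qed.

Lemma node_avoids I c n k : valid I ->
  (forall i, (i < k)%N -> ~~ inside I (gpt i)) ->
  forall i, (i < k + n)%N -> ~~ inside (node I c n) (gpt i).
Proof.
elim: n I c k => /= [|n IH] I c k vI Ik; first by rewrite addn0.
rewrite -addSnnS; apply: IH; first exact: valid_step.
exact: step_avoids.
Qed.

(** Cut points are collected over both branches, so that one finite list serves the first [n] bits
    of every point. *)
Fixpoint cuts I n : seq R :=
  if n is n'.+1 then
    cut I :: cuts (step I true) n' ++ cuts (step I false) n'
  else [::].

Lemma cuts_frac I n x : x \in cuts I n -> frac x.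
Proof.
elim: n I => //= n IH I; rewrite inE mem_cat => /predU1P[->|/orP[]/IH//].
exact: cut_frac.
Qed.

Lemma agree_cuts I n x y :
  {in cuts I n, forall p, (p <= x) = (p <= y)} -> agree n (code I x) (code I y).
Proof.
elim: n I => //= n IH I cutsP; apply/agreeS => /=.
have ss : (cut I <= x) = (cut I <= y) by apply: cutsP; rewrite mem_head.
split=> //; move: (IH (step I (cut I <= x))).
rewrite /comp /= -ss; apply => p pI; apply: cutsP.
by rewrite inE mem_cat; case: (cut I <= x) pI => ->; rewrite ?orbT.
Qed.

Lemma common_grid (s : seq R) : {in s, forall x, frac x} ->
  exists2 N, pi.-nat N & {in s, forall x, exists m, x = grid N m}.
Proof.
elim: s => [|x s IH] sP; first by exists 1%N.
have [|N piN NP] := IH; first by move=> y ys; apply: sP; rewrite inE ys orbT.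
have [M [m [piM ->]]] := sP x (mem_head _ _).
exists (M * N)%N; first by rewrite pnatM piM.
have M0 : (0 < M)%N by case/andP: piM.
have N0 : (0 < N)%N by case/andP: piN.
move=> y; rewrite inE => /predU1P[->|/NP[k ->]].
  by exists (N * m)%N; rewrite mulnC gridMl.
by exists (M * k)%N; rewrite gridMl.
Qed.

Lemma le_grid_cell N m k x : (0 < N)%N -> cell N k x ->
  (grid N m <= x) = (m <= k)%N.
Proof.
move=> N0; rewrite /cell/= in_itv/= => /andP[kx xk]; apply/idP/idP => mk.
  by rewrite -ltnS -(@ltr_grid R N)//; exact: le_lt_trans xk.
by apply: le_trans kx; rewrite ler_grid.
Qed.

(** The first [n] bits depend only on comparisons with finitely many cut points, and these are
    constant on the cells of a common denominator. *)
Lemma code_gridded I n : exists2 N, pi.-nat N &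
  forall k x y, cell N k x -> cell N k y -> agree n (code I x) (code I y).
Proof.
have [N piN NP] := common_grid (@cuts_frac I n).
have N0 : (0 < N)%N by case/andP: piN.
exists N => // k x y kx ky; apply: agree_cuts => p /NP[m ->].
by rewrite (le_grid_cell _ N0 kx) (le_grid_cell _ N0 ky).
Qed.

Definition halfline : R * \bar R := (0, +oo%E).

Lemma valid_halfline : valid halfline. Proof. by split => //=; rewrite ltry. Qed.

Lemma between_halfline x : between halfline x = (0 <= x).
Proof. by rewrite /between/= ltry andbT. Qed.

(** After [i.+1] cuts, [gpt i] is not interior to the node [J] containing both points; since
    [x < gpt i], the right end of [J] is at most [gpt i]. *)
Lemma code_lt_gpt i x y : 0 <= x -> 0 <= y ->
  agree i.+1 (code halfline x) (code halfline y) -> x < gpt i -> y < gpt i.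
Proof.
move=> x0 y0 xy xg; set J := node halfline (code halfline x) i.+1.
have /andP[Jx _] : between J x.
  by apply/between_node; rewrite ?between_halfline//; exact: valid_halfline.
have /andP[_ yJ] : between J y.
  by apply/between_node; rewrite ?between_halfline//; exact: valid_halfline.
have /negP : ~~ inside J (gpt i) by apply: (@node_avoids _ _ _ 0 valid_halfline).
rewrite /inside (le_lt_trans Jx xg)/= => /negP; rewrite -leNgt => Jg.
by rewrite -lte_fin; exact: lt_le_trans Jg.
Qed.

Definition scons b c n := if n is n'.+1 then c n' else b.

Lemma code_scons I x :
  code I x = scons (cut I <= x) (code (step I (cut I <= x)) x).
Proof. by apply/funext => -[]. Qed.

(** Induction on [n], splitting at the first cut: on each side the first bit is fixed and [Q]
    becomes a condition on the remaining bits. *)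
Lemma measurable_code I n (Q : set (nat -> bool)) :
  (forall c c', agree n c c' -> Q c -> Q c') ->
  measurable [set x | Q (code I x)].
Proof.
elim: n I Q => [|n IH] I Q QP.
  have [Q0|nQ0] := pselect (Q (fun=> true)).
    rewrite (_ : mkset _ = setT) //; apply/seteqP; split=> // x _.
    exact: QP Q0.
  rewrite (_ : mkset _ = set0) //; apply/seteqP; split=> // x Qx.
  by apply: nQ0; exact: QP Qx.
rewrite (_ : mkset _ =
  (`[cut I, +oo[ `&` [set x | Q (scons true (code (step I true) x))]) `|`
  (`]-oo, cut I[ `&` [set x | Q (scons false (code (step I false) x))])).
  apply: measurableU; apply: measurableI => //;
    apply: (IH _ (Q \o scons _)) => c c' cc'; apply: QP; exact/agreeS.
apply/seteqP; split=> x /=; rewrite !in_itv/= ?andbT [code I x]code_scons;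
  have [sx|xs] := leP (cut I) x.
- by left.
- by right.
- by case=> -[].
- by case=> -[].
Qed.

End interval_coding.

(** * The measure attached to a set of primes *)
Section grid_measure.
Context {R : realType} {X : pmetricType R}.
Variables (e : X -> nat -> bool) (d : (nat -> bool) -> X).
Hypothesis ed : is_coding e d.
Variables (pi : nat_pred) (pi2 : 2%N \in pi).
Local Notation lambda := (@lebesgue_measure R).

(** [X] itself plays the role of K. A positive point of G goes to its right copy; the half-line
    misses the left copies and the point at infinity. *)
Definition phi (x : R) : X := d (code pi halfline x).

Lemma e_phi x : e (phi x) = code pi halfline x.
Proof. by have [_ dK _ _] := ed; rewrite /phi dK. Qed.

Lemma measurable_phi :
  measurable_fun [set: measurableTypeR R] (phi : measurableTypeR R -> borel X).
Proof.
apply: (@measurability _ _ (measurableTypeR R) (borel X) setT phi (@open X)) => //.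
move=> _ [B oB <-]; rewrite setTI (bigcup_inner ed oB) preimage_bigcup.
apply: bigcup_measurable => n _.
apply: (measurable_code pi halfline (n := n) (Q := [set c | inner e n B (d c)])).
move=> c c' cc' /=; apply: determined_inner.
by have [_ dK _ _] := ed; rewrite !dK.
Qed.

Lemma grid_measure_ex : exists mu : {measure set (borel X) -> \bar R},
  forall A, mu A = lambda (phi @^-1` A `&` `[0, +oo[).
Proof.
have mE : measurable (`[0, +oo[ : set (measurableTypeR R)) by exact: measurable_itv.
unshelve eexists (pushforward (mrestr lambda mE)
  (phi : measurableTypeR R -> borel X)).
  exact: measurable_phi.
by [].
Qed.

Variable mu : {measure set (borel X) -> \bar R}.
Hypothesis muE : forall A, mu A = lambda (phi @^-1` A `&` `[0, +oo[).

Lemma measurable_pre (A : set (borel X)) : measurable A ->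
  measurable (phi @^-1` A : set R).
Proof. by move=> mA; rewrite -[_ @^-1` _]setTI; exact: measurable_phi. Qed.

Lemma gridded_pre (U : set X) : compact [set: X] -> clopen U ->
  exists2 N, pi.-nat N & gridded N (phi @^-1` U).
Proof.
move=> cX /(clopen_determined ed cX)[n Un].
have [N piN NP] := code_gridded pi (@halfline R) n.
by exists N => // k x y kx ky; apply: Un; rewrite !e_phi; exact: NP kx ky.
Qed.

Lemma clopen_below N m : pi.-nat N -> exists2 V : set X, clopen V &
  forall x : R, 0 <= x -> V (phi x) <-> x < grid N m.
Proof.
move=> piN; have [|i <-] := @frac_gpt R pi (grid N m); first by exists N, m.
(* The witness is the union of the cylinders of length [i.+1] around codes of points below [gpt i];
   by [code_lt_gpt] it catches no point of the half-line from [gpt i] on. *)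
exists [set z | exists x, [/\ 0 <= x, x < @gpt R pi i &
    agree i.+1 (code pi halfline x) (e z)]].
  apply: (determined_clopen ed (n := i.+1)) => z t zt [x [x0 xg xz]].
  by exists x; split=> //; exact: agree_trans zt.
move=> x x0; split=> [[y [y0 yg]]|xg]; last by exists x; rewrite e_phi.
by rewrite e_phi => yx; exact: code_lt_gpt yx yg.
Qed.

Lemma mu_below N m (V : set (borel X)) :
  (forall x : R, 0 <= x -> V (phi x) <-> x < grid N m) -> mu V = (grid N m)%:E.
Proof.
move=> VP; rewrite muE (_ : _ `&` _ = `[0, grid N m[%classic).
  rewrite lebesgue_measure_itv/= lte_fin -EFinB subr0.
  by have := @grid_ge0 R N m; rewrite le_eqVlt => /predU1P[<-|->//]; rewrite ltxx.
apply/seteqP; split=> x /=; rewrite !in_itv/= ?andbT.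
  by move=> [+ x0]; rewrite VP// x0.
by move=> /andP[x0 xm]; rewrite VP.
Qed.

Lemma clopen_value N m : pi.-nat N ->
  exists2 V : set X, clopen V & mu V = (grid N m)%:E.
Proof.
by move=> /(clopen_below m)[V cV VP]; exists V => //; exact: mu_below VP.
Qed.

Lemma value_clopen (U : set X) : compact [set: X] -> clopen U ->
  (mu U < +oo)%E ->
  exists N m, pi.-nat N /\ mu U = (grid N m)%:E.
Proof.
move=> cX cU; have [N piN gU] := gridded_pre cX cU.
have N0 : (0 < N)%N by case/andP: piN.
have mU := measurable_pre (clopen_measurable cU).
by rewrite muE => /(lambda_gridded N0 mU gU)[m ->]; exists N, m.
Qed.

Lemma mu_full : full mu.
Proof.
have [_ _ _ base] := ed.
move=> U oU [z Uz]; have [n nU] := base _ _ oU Uz.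
set J := node pi (@halfline R) (e z) n.
have [J0 J12] : valid J := valid_node pi2 _ _ valid_halfline.
(* The node may be unbounded; a finite [r] gives an interval of finite positive length in the
   preimage of [U]. *)
have [r Jr rJ] : exists2 r : R, J.1 < r & (r%:E <= J.2)%E.
  case: (J.2) J12 => [b|_|]//; first by rewrite lte_fin; exists b.
  by exists (J.1 + 1); [rewrite ltrDl | exact: leey].
have sub : `[J.1, r[ `<=` phi @^-1` U `&` `[0, +oo[.
  move=> x /=; rewrite !in_itv/= andbT => /andP[Jx xr]; split.
    apply: nU; rewrite e_phi.
    have /(between_node pi2 _ _ _ valid_halfline)[]// : between J x.
    by rewrite /between Jx/=; apply: lt_le_trans rJ; rewrite lte_fin.
  exact: le_trans Jx.
rewrite muE; apply: (@lt_le_trans _ _ (lambda `[J.1, r[%classic)).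
  by rewrite lebesgue_measure_itv/= lte_fin Jr -EFinB lte_fin subr_gt0.
apply: le_measure => //; rewrite inE; first exact: measurable_itv.
by apply: measurableI => //; apply: measurable_pre; exact: sub_sigma_algebra.
Qed.

Lemma mu_infinite : mu [set: X] = +oo%E.
Proof. by rewrite muE preimage_setT setTI lebesgue_measure_itv/= ltry. Qed.

(** Each [x] of the half-line lies below an integer, so [phi x] has a clopen neighbourhood of finite
    measure: the defective set misses the image of the half-line. *)
Lemma mu_defective : mu (defective mu) = 0%E.
Proof.
rewrite muE (_ : _ `&` _ = set0) ?measure0//; apply/seteqP; split=> // x [].
rewrite /= in_itv/= andbT => dx x0.
have [V cV VP] := clopen_below (Num.bound x) (isT : pi.-nat 1).
have Vx : V (phi x) by rewrite VP// /grid divr1; exact: archi_boundP.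
by have := dx V cV Vx; rewrite (mu_below VP).
Qed.

(** The cells of length less than the measure of an atom [A] cut it into countably many pieces, each
    null by atomicity, so [A] would be null. *)
Lemma mu_non_atomic : non_atomic mu.
Proof.
move=> A [mA A0 atomA].
have [r r0 rA] : exists2 r : R, 0 < r & (r%:E <= mu A)%E.
  case: (mu A) A0 => [b|_|]//; first by rewrite lte_fin; exists b.
  by exists 1; [exact: ltr01 | exact: leey].
have [N piN Nr] := fine_pi pi2 r0.
have N0 : (0 < N)%N by case/andP: piN.
have /choice[V VP] m : exists V : set X,
    clopen V /\ forall x : R, 0 <= x -> V (phi x) <-> x < grid N m.
  by have [V] := clopen_below m piN; exists V.
pose C k : set (borel X) := V k.+1 `\` V k.
have mC k : measurable (C k).
  by apply: measurableD; apply: clopen_measurable; exact: (VP _).1.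
have CP k x : 0 <= x -> C k (phi x) <-> cell N k x.
  move=> x0; rewrite /cell/= in_itv/= /C/= (VP _).2// (VP _).2//.
  by rewrite -[grid N k <= x]negbK -ltNge; split=> [[-> /negP->]|/andP[/negP]].
have mAC k : measurable (A `&` C k) by exact: measurableI.
have AC0 k : mu (A `&` C k) = 0%E.
  apply: atomA => //; apply: le_lt_trans (_ : (grid N 1)%:E < _)%E; last first.
    by apply: lt_le_trans rA; rewrite lte_fin.
  rewrite muE -(@lambda_cell R N k N0); apply: le_measure.
  - by rewrite inE; apply: measurableI => //; exact: measurable_pre.
  - by rewrite inE; exact: measurable_itv.
  - move=> x [[_ Cx]] /=; rewrite in_itv/= andbT => x0.
    by rewrite -CP.
suff : (mu A <= 0)%E by rewrite leNgt A0.
pose B k := phi @^-1` (A `&` C k) `&` `[0, +oo[.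
have B0 : (\sum_(0 <= k <oo) lambda (B k) = 0)%E.
  by apply: eseries0 => k _ _; rewrite -muE AC0.
rewrite muE -B0; apply: measure_sigma_subadditive.
- by move=> k; apply: measurableI => //; exact: measurable_pre.
- by apply: measurableI => //; exact: measurable_pre.
- move=> x [Ax x0]; have x0' : 0 <= x by move: x0; rewrite /= in_itv/= andbT.
  by have [k kx] := cellP N0 x0'; exists k => //; split=> //; split=> //; apply/CP.
Qed.

Lemma mu_Minfty0 : Minfty0 mu.
Proof.
split; last exact: mu_defective.
by split; [exact: mu_full | exact: mu_non_atomic | exact: mu_infinite].
Qed.

Lemma mu_good : compact [set: X] -> good X mu.
Proof.
move=> cX; split; first exact: mu_Minfty0.
move=> U V cU cV UV.
have [N1 piN1 gU] := gridded_pre cX cU.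
have [N2 piN2 gV] := gridded_pre cX cV.
have N10 : (0 < N1)%N by case/andP: piN1.
have N20 : (0 < N2)%N by case/andP: piN2.
have N0 : (0 < N1 * N2)%N by rewrite muln_gt0 N10.
have {gU} gU : gridded (N1 * N2) (phi @^-1` U) by rewrite mulnC; exact: griddedMl.
have {gV} gV : gridded (N1 * N2) (phi @^-1` V) by exact: griddedMl.
have mU := measurable_pre (clopen_measurable cU).
have mV := measurable_pre (clopen_measurable cV).
have [m mUm] : exists m, mu U = (grid (N1 * N2) m)%:E.
  have : (mu U < +oo)%E by exact: lt_le_trans UV (leey _).
  by rewrite muE; exact: lambda_gridded.
have [t mt] : exists t, (m < cnt (N1 * N2) (phi @^-1` V) t)%N.
  by apply: lambda_cnt_gt => //; rewrite -mUm -muE.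
(* [V] is truncated at the grid point [s], below which it has exactly the [m] cells needed to match
   [U]. *)
have [s sm] := cnt_ivt (ltnW mt).
have [W cW WP] : exists2 W : set X, clopen W &
    forall x : R, 0 <= x -> W (phi x) <-> x < grid (N1 * N2) s.
  by apply: clopen_below; rewrite pnatM piN1.
exists (V `&` W); split; [exact: clopenI | exact: subIsetl | ].
rewrite mUm -sm -lambda_initial// muE; congr (lambda _).
apply/seteqP; split=> x /=; rewrite !in_itv/= andbT.
  by move=> [[Vx Wx] x0]; split=> //; rewrite x0/= -WP.
by move=> [Vx /andP[x0 xs]]; split=> //; split=> //; rewrite WP.
Qed.

End grid_measure.

(** * Lower bound: primes distinguish continuum many classes *)

Section at_least_continuum.
Context {R : realType} {X : pmetricType R}.
Implicit Types mu nu : {measure set (borel X) -> \bar R}.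
Hypothesis cantorX : cantor_like X.

Definition clopen_values mu (pi : nat_pred) :=
  (forall N m, pi.-nat N -> exists2 V : set X, clopen V & mu V = (grid N m)%:E) /\
  (forall U : set X, clopen U -> (mu U < +oo)%E ->
    exists N m, pi.-nat N /\ mu U = (grid N m)%:E).

Lemma good_measure_ex (pi : nat_pred) : 2%N \in pi ->
  exists2 mu, good X mu & clopen_values mu pi.
Proof.
move=> pi2; have [_ cX _ _] := cantorX.
have [e [d ed]] := cantor_coding cantorX.
have [mu muE] := grid_measure_ex ed pi.
exists mu; first exact: mu_good ed _ pi2 _ muE cX.
split=> [N m piN|U cU Uoo]; first exact: clopen_value ed _ pi2 _ muE _ _ piN.
exact: value_clopen ed _ _ muE _ cX cU Uoo.
Qed.

Lemma weakly_homeomorphic_primes mu nu (pi rho : nat_pred) p :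
  clopen_values mu pi -> clopen_values nu rho -> weakly_homeomorphic mu nu ->
  prime p -> p \in pi -> p \in rho.
Proof.
move=> [mu1 mu2] [nu1 nu2] [h [C [[g [hg gh ch cg]] C0 hmu]]] pp ppi.
have p0 : (0 < p)%N := prime_gt0 pp.
have nuE A : clopen A -> mu (h @^-1` A) = (C%:E * nu A)%E.
  by move=> cA; apply: hmu; exact: clopen_measurable.
(* A clopen set of [nu]-measure 1 shows that [C] is itself a clopen value of [mu]. *)
have [V cV V1] := nu1 1%N 1%N isT.
have muV : mu (h @^-1` V) = C%:E by rewrite nuE// V1 /grid divr1 mule1.
have [|N [m [piN CE]]] := mu2 _ (preimage_clopen cV ch); first by rewrite muV ltry.
(* Since [p] is in [pi], [C / p] is a value of [mu] too; dividing by [C] makes [1 / p] a value of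
   [nu]. *)
have [W cW WE] : exists2 W : set X, clopen W & mu W = (grid (p * N) m)%:E.
  by apply: mu1; rewrite pnatM pnatE// ppi.
have cgW : clopen (g @^-1` W) by exact: preimage_clopen cW cg.
have nuW : nu (g @^-1` W) = (p%:R^-1)%:E.
  have := nuE _ cgW; rewrite (_ : h @^-1` _ = W); last first.
    by apply/seteqP; split=> x /=; rewrite hg.
  have CR : C = grid N m by apply: EFin_inj; rewrite -CE.
  rewrite WE; have -> : grid (p * N) m = C * p%:R^-1.
    by rewrite CR /grid natrM invfM mulrA mulrAC.
  move=> /(congr1 (fun x => C^-1%:E * x)%E).
  by rewrite muleA -!EFinM mulKf ?mulVf ?gt_eqF// mul1e.
have [|N' [m' [rN']]] := nu2 _ cgW; first by rewrite nuW ltry.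
have N'0 : (0 < N')%N by case/andP: rN'.
(* From [1 / p = m' / N'], the prime [p] divides [N'], all of whose prime factors are in [rho]. *)
rewrite nuW => -[] /eqP; rewrite /grid -[X in X == _]mul1r.
rewrite eqr_div ?pnatr_eq0 -?lt0n// mul1r -natrM eqr_nat => /eqP N'E.
rewrite -(pnatE rho pp); apply: pnat_dvd rN'.
by rewrite N'E dvdn_mull.
Qed.

(** Some increasing sequence of primes, not necessarily all odd ones. Starting at 3 leaves 2 free to
    belong to every [prime_set]. *)
Fixpoint odd_prime n : nat :=
  if n is n'.+1 then s2val (prime_above (odd_prime n')) else 3.

Lemma odd_prime_lt : {homo odd_prime : m n / (m < n)%N}.
Proof.
apply: homo_ltn => [|n]; first exact: ltn_trans.
by rewrite [odd_prime n.+1]/=; case: prime_above.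
Qed.

Lemma odd_prime_inj : injective odd_prime.
Proof.
by move=> m n mn; case: (ltngtP m n) => // /odd_prime_lt; rewrite mn ltnn.
Qed.

Lemma odd_primeP n : prime (odd_prime n) && (2 < odd_prime n)%N.
Proof.
elim: n => //= n /andP[_ IH]; case: prime_above => p lt_p pp /=.
by rewrite pp (ltn_trans IH).
Qed.

Definition prime_set (b : nat -> bool) : nat_pred :=
  [pred p | (p == 2%N) || `[< exists2 n, b n & p = odd_prime n >]].

Lemma odd_prime_set b n : (odd_prime n \in prime_set b) = b n.
Proof.
have /andP[_ gt2] := odd_primeP n.
rewrite inE/= gtn_eqF//=; apply/asboolP/idP => [[k bk /odd_prime_inj->//]|bn].
by exists n.
Qed.

Lemma card_weak_classes_ge :
  [set: nat -> bool] #<= [set weak_class mu | mu in good X].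
Proof.
have /choice[mu muP] b : exists mu, good X mu /\ clopen_values mu (prime_set b).
  by have [|mu] := @good_measure_ex (prime_set b); [rewrite inE | exists mu].
have sub b b' n : weak_class (mu b) = weak_class (mu b') -> b n -> b' n.
  move=> bb'; rewrite -!(odd_prime_set _ n).
  have /andP[pn _] := odd_primeP n.
  apply: weakly_homeomorphic_primes (muP b).2 (muP b').2 _ pn.
  have : weak_class (mu b') (mu b').
    by split; [exact: (muP b').1 | exact: weakly_homeomorphic_refl].
  by rewrite -bb' => -[].
have inj : {in [set: nat -> bool] &, injective (fun b => weak_class (mu b))}.
  move=> b b' _ _ bb'; apply/funext => n.
  by apply/idP/idP; exact: sub.
rewrite -(card_le_eql (inj_card_eq inj)); apply: subset_card_le.
by move=> _ [b _ <-]; exists (mu b) => //; exact: (muP b).1.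
Qed.

End at_least_continuum.

Theorem theorem2p18 (R : realType) (X : pmetricType R) (cantorX : cantor_like X) :
  [set weak_class mu | mu in good X] #= [set: nat -> bool].
Proof.
rewrite card_eq_le; apply/andP; split.
- exact: card_weak_classes_le.
- exact: card_weak_classes_ge.
Qed.
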